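(* Let $(R,m)$ be a Noetherian local domain and let $B$ be a big Cohen-Macaulay algebra over $R$. Then the algebra closure $\mathrm{cl}_B$ is a Dietz closure that satisfies the Algebra Axiom.
   Context: All rings are commutative with unity, and Noetherian unless otherwise specified (the algebra $B$ need not be Noetherian or finitely generated). Big Cohen-Macaulay algebra: an $R$-algebra $B$ such that $mB \neq B$ and every system of parameters for $R$ is a regular sequence on $B$. Closure operation: a closure operation $\mathrm{cl}$ on a ring $R$ is a map $N \mapsto N_M^{\mathrm{cl}}$ assigning to each submodule $N$ of a finitely generated $R$-module $M$ a submodule $N_M^{\mathrm{cl}}$ of $M$ such that for $N \subseteq N' \subseteq M$ finitely generated: $N \subseteq N_M^{\mathrm{cl}}$; $(N_M^{\mathrm{cl}})_M^{\mathrm{cl}} = N_M^{\mathrm{cl}}$; $N_M^{\mathrm{cl}} \subseteq (N')_M^{\mathrm{cl}}$. Algebra closure: for an $R$-algebra $B$ and finitely generated $R$-modules $N \subseteq M$, $u \in N_M^{\mathrm{cl}_B}$ if and only if $1 \otimes u \in \mathrm{im}(B \otimes_R N \to B \otimes_R M)$. Dietz closure: a closure operation $\mathrm{cl}$ on a local domain $(R,m)$ is a Dietz closure if for all finitely generated $R$-modules $N \subseteq M$ and $W$: (1) (Functoriality) for every homomorphism $f: M \to W$, $f(N_M^{\mathrm{cl}}) \subseteq f(N)_W^{\mathrm{cl}}$; (2) (Semi-residuality) if $N_M^{\mathrm{cl}} = N$ then $0_{M/N}^{\mathrm{cl}} = 0$; (3) (Faithfulness) $m_R^{\mathrm{cl}}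 = m$; (4) (Generalized Colon-Capturing) if $x_1,\dots,x_{k+1}$ is a partial system of parameters for $R$, $J = (x_1,\dots,x_k)$, $f: M \to R/J$ is a surjective homomorphism and $v \in M$ satisfies $f(v) = x_{k+1} + J$, then $(Rv)_M^{\mathrm{cl}} \cap \ker f \subseteq (Jv)_M^{\mathrm{cl}}$. Phantom extension: let $M$ be a finitely generated $R$-module and $\alpha: R \to M$ an injective $R$-linear map with cokernel $Q$. Let $\epsilon \in \mathrm{Ext}^1_R(Q,R)$ correspond to $0 \to R \to M \to Q \to 0$. Then $\alpha$ is $\mathrm{cl}$-phantom if $\epsilon \in 0^{\mathrm{cl}}_{\mathrm{Ext}^1_R(Q,R)}$. Equivalently, if $P_\bullet$ is a projective resolution of $Q$ by finitely generated projectives and $\phi \in \mathrm{Hom}_R(P_1,R)$ is a cocycle representing $\epsilon$, then $\phi$ lies in the $\mathrm{cl}$-closure, in $\mathrm{Hom}_R(P_1,R)$, of the image of $\mathrm{Hom}_R(P_0,R) \to \mathrm{Hom}_R(P_1,R)$. Algebra Axiom: for every finitely generated $R$-module $M$, if $\alpha: R \to M$, $1 \mapsto e_1$, is $\mathrm{cl}$-phantom, then $\alpha': R \to \mathrm{Sym}^2(M)$, $1 \mapsto e_1 \otimes e_1$, is $\mathrm{cl}$-phantom. *)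

(* Defs.v *)
From HB Require Import structures.
From mathcomp Require Import all_boot all_algebra.
From mathcomp Require Import generic_quotient ring_quotient freeg.
From mathcomp Require Import boolp classical_sets.

Set Implicit Arguments.
Unset Strict Implicit.
Unset Printing Implicit Defensive.

Import GRing.Theory.
Local Open Scope ring_scope.
Local Open Scope quotient_scope.

(* Submodules of M are the library's [submodClosed M]; their boolean
   membership is classical.  An ideal of R is a submodule of the regular
   module R^o, so it may be the whole ring. *)
Notation ideal R := (submodClosed R^o).

Section Submodules.
Variables (R : comNzRingType) (M : lmodType R).
Implicit Types (A : set M) (N : submodClosed M).

Definition span A : {pred M} :=
  fun x => `[< forall N, (forall y, A y -> y \in N) -> x \in N >].

Lemma span_submod A : subsemimod_closed (span A).
Proof.
split; first split.
- by apply/asboolP => N _; exact: rpred0.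
- move=> x y /asboolP xA /asboolP yA; apply/asboolP => N AN.
  by rewrite rpredD ?xA ?yA.
- by move=> a x /asboolP xA; apply/asboolP => N AN; rewrite rpredZ ?xA.
Qed.
HB.instance Definition _ A := GRing.isSubmodClosed.Build R M (span A)
  (span_submod A).

Definition zero_submod : {pred M} := pred1 0.

Lemma zero_submod_closed : subsemimod_closed zero_submod.
Proof.
split; first split; rewrite ?inE //.
- by move=> x y; rewrite !inE => /eqP-> /eqP->; rewrite addr0.
- by move=> a x; rewrite !inE => /eqP->; rewrite scaler0.
Qed.
HB.instance Definition _ := GRing.isSubmodClosed.Build R M zero_submod
  zero_submod_closed.

Definition fin_gen : Prop := exists s : seq M, forall x, x \in span [set` s].

End Submodules.
Arguments zero_submod {R} M _.
Arguments fin_gen {R} M.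

Section SubmoduleType.
Variables (R : comNzRingType) (M : lmodType R) (N : submodClosed M).

Definition submod := {x : M | x \in N}.
HB.instance Definition _ := SubChoice.on submod.
HB.instance Definition _ := [SubChoice_isSubLmodule of submod by <:].

Definition submod_incl : {linear submod -> M} := \val.

End SubmoduleType.

Section QuotientModule.
Variables (R : comNzRingType) (M : lmodType R) (N : submodClosed M).

(* [Quotient.quot] asks for closure under opposites, which [submodClosed]
   does not record *)
Definition zmod_of_submod : {pred M} := fun x => x \in N.

Lemma zmod_of_submod_closed : zmod_closed zmod_of_submod.
Proof.
split=> [|x y xN yN]; first exact: rpred0.
rewrite -[_ \in _]/(x - y \in N).
by rewrite rpredD// -scaleN1r rpredZ.
Qed.
HB.instance Definition _ := GRing.isZmodClosed.Build M zmod_of_submod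
  zmod_of_submod_closed.

Definition quotmod : Type := Quotient.quot zmod_of_submod.
HB.instance Definition _ := GRing.Zmodule.on quotmod.

Definition quot_pi (x : M) : quotmod := \pi x.

Lemma quot_piB : zmod_morphism quot_pi.
Proof. by move=> x y; rewrite /quot_pi !piE. Qed.
HB.instance Definition _ := GRing.isZmodMorphism.Build M quotmod quot_pi
  quot_piB.

Lemma quot_pi_eq x y : (quot_pi x == quot_pi y) = (x - y \in N).
Proof. by rewrite -[RHS]/(x - y \in zmod_of_submod) Quotient.idealrBE. Qed.

Lemma quot_pi_surj q : exists x, quot_pi x = q.
Proof. by exists (repr (q : Quotient.quot _)); exact: reprK. Qed.

Definition quot_scale (a : R) (q : quotmod) : quotmod :=
  quot_pi (a *: repr (q : Quotient.quot _)).

Lemma quot_scale_pi a x : quot_scale a (quot_pi x) = quot_pi (a *: x).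
Proof.
apply/eqP; rewrite quot_pi_eq -scalerBr rpredZ// -quot_pi_eq.
by rewrite {1}/quot_pi reprK.
Qed.

Fact quot_scaleA a b q :
  quot_scale a (quot_scale b q) = quot_scale (a * b) q.
Proof. by have [x <-] := quot_pi_surj q; rewrite !quot_scale_pi scalerA. Qed.

Fact quot_scale1 : left_id 1 quot_scale.
Proof. by move=> q; have [x <-] := quot_pi_surj q; rewrite quot_scale_pi scale1r. Qed.

Fact quot_scaleDr : right_distributive quot_scale +%R.
Proof.
move=> a p q; have [x <-] := quot_pi_surj p; have [y <-] := quot_pi_surj q.
by rewrite -raddfD !quot_scale_pi -raddfD scalerDr.
Qed.

Fact quot_scaleDl q : {morph quot_scale^~ q : a b / a + b}.
Proof.
move=> a b; have [x <-] := quot_pi_surj q.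
by rewrite !quot_scale_pi -raddfD scalerDl.
Qed.

HB.instance Definition _ := GRing.Zmodule_isLmodule.Build R quotmod
  quot_scaleA quot_scale1 quot_scaleDr quot_scaleDl.

Fact quot_piZ : scalable quot_pi.
Proof. by move=> a x; rewrite -quot_scale_pi. Qed.
HB.instance Definition _ := GRing.isScalable.Build R M quotmod *:%R quot_pi
  quot_piZ.

End QuotientModule.
Arguments quot_pi {R M} N.

Section Lift.
Variables (R : comNzRingType) (M V : lmodType R) (N : submodClosed M).
Variable f : {linear M -> V}.

Definition quot_lift (q : quotmod N) : V := f (repr (q : Quotient.quot _)).

Lemma quot_liftE (f0 : forall x, x \in N -> f x = 0) x :
  quot_lift (quot_pi N x) = f x.
Proof.
apply/eqP; rewrite -subr_eq0 -raddfB; apply/eqP/f0.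
by rewrite -quot_pi_eq {1}/quot_pi reprK.
Qed.
End Lift.

Section LinearImage.
Variables (R : comNzRingType) (U V : lmodType R) (f : {linear U -> V}).

Definition lin_image (N : submodClosed U) : {pred V} :=
  fun v => `[< exists2 u, u \in N & f u = v >].

Lemma lin_image_closed N : subsemimod_closed (lin_image N).
Proof.
split; first split.
- by apply/asboolP; exists 0; rewrite ?rpred0 ?raddf0.
- move=> _ _ /asboolP[x xN <-] /asboolP[y yN <-]; apply/asboolP.
  by exists (x + y); rewrite ?rpredD ?raddfD.
- move=> a _ /asboolP[x xN <-]; apply/asboolP.
  by exists (a *: x); rewrite ?rpredZ ?linearZ.
Qed.
HB.instance Definition _ N := GRing.isSubmodClosed.Build R V (lin_image N)
  (lin_image_closed N).

Definition lin_range : {pred V} := fun v => `[< exists u, f u = v >].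

Lemma lin_range_closed : subsemimod_closed lin_range.
Proof.
split; first split.
- by apply/asboolP; exists 0; rewrite raddf0.
- move=> _ _ /asboolP[x <-] /asboolP[y <-]; apply/asboolP.
  by exists (x + y); rewrite raddfD.
- by move=> a _ /asboolP[x <-]; apply/asboolP; exists (a *: x); rewrite linearZ.
Qed.
HB.instance Definition _ := GRing.isSubmodClosed.Build R V lin_range
  lin_range_closed.

Definition lin_ker : {pred U} := fun u => f u == 0.

Lemma lin_ker_closed : subsemimod_closed lin_ker.
Proof.
split; first split; rewrite /lin_ker.
- by rewrite -topredE /= raddf0.
- move=> x y /eqP x0 /eqP y0; apply/eqP.
  by rewrite -[LHS]/(f (x + y)) raddfD /= x0 y0 addr0.
- move=> a x /eqP x0; apply/eqP.
  by rewrite -[LHS]/(f (a *: x)) linearZ /= x0 scaler0.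
Qed.
HB.instance Definition _ := GRing.isSubmodClosed.Build R U lin_ker
  lin_ker_closed.

End LinearImage.

(* M (x)_R N: the free module on M * N modulo bilinearity *)
Section Tensor.
Variables (R : comNzRingType) (M N : lmodType R).

Definition pre_tensor := {freeg (M * N)%type / R}.
Definition pre_tens (x : M) (y : N) : pre_tensor := [freeg [:: (1, (x, y))]].

Definition tensor_rel : set pre_tensor := [set t |
  [\/ exists x x' y, t = pre_tens (x + x') y - pre_tens x y - pre_tens x' y,
      exists x y y', t = pre_tens x (y + y') - pre_tens x y - pre_tens x y',
      exists a x y, t = pre_tens (a *: x) y - a *: pre_tens x y |
      exists a x y, t = pre_tens x (a *: y) - a *: pre_tens x y]].

Definition tensor := quotmod (span tensor_rel).
HB.instance Definition _ := GRing.Lmodule.on tensor.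

Definition tens (x : M) (y : N) : tensor := quot_pi _ (pre_tens x y).

End Tensor.

Section TensorTheory.
Variables (R : comNzRingType) (M N : lmodType R).
Local Notation tens := (@tens R M N).

Lemma tens_bilinear :
  [/\ forall x x' y, tens (x + x') y = tens x y + tens x' y,
      forall x y y', tens x (y + y') = tens x y + tens x y',
      forall a x y, tens (a *: x) y = a *: tens x y &
      forall a x y, tens x (a *: y) = a *: tens x y].
Proof.
have tensP t : tensor_rel t -> quot_pi (span (@tensor_rel R M N)) t = 0.
  move=> tr; apply/eqP; rewrite -[0](raddf0 (quot_pi _)) quot_pi_eq subr0.
  by apply/asboolP => K; apply.
split=> [x x' y|x y y'|a x y|a x y]; apply/eqP; rewrite -subr_eq0.
- rewrite opprD addrA -[X in X == _]/(quot_pi _ (pre_tens (x + x') y) -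
    quot_pi _ (pre_tens x y) - quot_pi _ (pre_tens x' y)) -!raddfB.
  by apply/eqP/tensP; constructor 1; exists x, x', y.
- rewrite opprD addrA -[X in X == _]/(quot_pi _ (pre_tens x (y + y')) -
    quot_pi _ (pre_tens x y) - quot_pi _ (pre_tens x y')) -!raddfB.
  by apply/eqP/tensP; constructor 2; exists x, y, y'.
- rewrite -[X in X == _]/(quot_pi _ (pre_tens (a *: x) y) -
    a *: quot_pi _ (pre_tens x y)) -linearZ -raddfB.
  by apply/eqP/tensP; constructor 3; exists a, x, y.
- rewrite -[X in X == _]/(quot_pi _ (pre_tens x (a *: y)) -
    a *: quot_pi _ (pre_tens x y)) -linearZ -raddfB.
  by apply/eqP/tensP; constructor 4; exists a, x, y.
Qed.

Variables (V : lmodType R) (h : M -> N -> V).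

Definition pre_tensor_lift (t : pre_tensor M N) : V :=
  fglift (fun xy => h xy.1 xy.2) t.

Fact pre_tensor_liftB : zmod_morphism pre_tensor_lift.
Proof. exact: lift_is_additive. Qed.
HB.instance Definition _ := GRing.isZmodMorphism.Build (pre_tensor M N) V
  pre_tensor_lift pre_tensor_liftB.

Fact pre_tensor_liftZ : scalable pre_tensor_lift.
Proof.
move=> a t; rewrite -[in RHS](freeg_sumE t) [a *: t]/(fgscale a t).
rewrite !raddf_sum; apply: eq_bigr => z _ /=.
by rewrite /pre_tensor_lift !liftU scalerA.
Qed.
HB.instance Definition _ := GRing.isScalable.Build R (pre_tensor M N) V
  *:%R pre_tensor_lift pre_tensor_liftZ.

Definition tensor_lift : tensor M N -> V := quot_lift pre_tensor_lift.

Hypothesis hDl : forall x x' y, h (x + x') y = h x y + h x' y.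
Hypothesis hDr : forall x y y', h x (y + y') = h x y + h x y'.
Hypothesis hZl : forall a x y, h (a *: x) y = a *: h x y.
Hypothesis hZr : forall a x y, h x (a *: y) = a *: h x y.

Lemma pre_tensor_lift0 t : t \in span (@tensor_rel R M N) ->
  pre_tensor_lift t = 0.
Proof.
move=> /asboolP tN; pose f : {linear pre_tensor M N -> V} := pre_tensor_lift.
apply/eqP/(tN (lin_ker f)) => {tN}t []; move=> [x [y [z ->]]].
all: rewrite -topredE /= /lin_ker.
all: rewrite !raddfB /= ?pre_tensor_liftZ /pre_tensor_lift !liftU !scale1r /=.
- by rewrite hDl addrAC addrK subrr.
- by rewrite hDr addrAC addrK subrr.
- by rewrite hZl subrr.
- by rewrite hZr subrr.
Qed.

Lemma tensor_lift_tens x y : tensor_lift (tens x y) = h x y.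
Proof.
rewrite /tensor_lift quot_liftE; last exact: pre_tensor_lift0.
by rewrite /= /pre_tensor_lift liftU scale1r.
Qed.

Lemma tensor_lift_linear : linear tensor_lift.
Proof.
have pl0 := pre_tensor_lift0.
move=> a p q; have [x <-] := quot_pi_surj p; have [y <-] := quot_pi_surj q.
by rewrite -linearP /tensor_lift !quot_liftE ?linearP.
Qed.

End TensorTheory.

Section TensorMap.
Variables (R : comNzRingType) (M N N' : lmodType R) (g : {linear N -> N'}).

Definition tensor_mapr : tensor M N -> tensor M N' :=
  tensor_lift (fun x y => tens x (g y)).

Lemma tensor_mapr_tens x y : tensor_mapr (tens x y) = tens x (g y).
Proof.
have [Dl Dr Zl Zr] := tens_bilinear M N'.
by apply: tensor_lift_tens => *; rewrite ?raddfD ?linearZ ?Dl ?Dr ?Zl ?Zr.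
Qed.

Fact tensor_mapr_linear : linear tensor_mapr.
Proof.
have [Dl Dr Zl Zr] := tens_bilinear M N'.
by apply: tensor_lift_linear => *; rewrite ?raddfD ?linearZ ?Dl ?Dr ?Zl ?Zr.
Qed.
HB.instance Definition _ := GRing.isLinear.Build R (tensor M N) (tensor M N')
  *:%R tensor_mapr tensor_mapr_linear.

End TensorMap.
Arguments tensor_mapr {R} M {N N'} g.

Definition sym2_rel (R : comNzRingType) (M : lmodType R) : set (tensor M M) :=
  [set t | exists x y, t = tens x y - tens y x].

Definition sym2 (R : comNzRingType) (M : lmodType R) : Type :=
  quotmod (span (@sym2_rel R M)).
HB.instance Definition _ (R : comNzRingType) (M : lmodType R) :=
  GRing.Lmodule.on (sym2 M).

Definition sym2_mul (R : comNzRingType) (M : lmodType R) (x y : M) : sym2 M :=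
  quot_pi _ (tens x y).

Section Hom.
Variables (R : comNzRingType) (U V : lmodType R).
Implicit Types (a : R) (f g h : {linear U -> V}).

Lemma linear_ext f g : f =1 g -> f = g.
Proof.
case: f g => [f [[fD] [fZ]]] [g [[gD] [gZ]]] /= /funext fg.
case: _ / fg in gD gZ *.
by rewrite (Prop_irrelevance gD fD) (Prop_irrelevance gZ fZ).
Qed.

HB.instance Definition _ := gen_eqMixin {linear U -> V}.
HB.instance Definition _ := gen_choiceMixin {linear U -> V}.

Definition lin_zero : {linear U -> V} := \0.
Definition lin_add f g : {linear U -> V} := f \+ g.
Definition lin_opp f : {linear U -> V} := \- f.
Definition lin_scale a f : {linear U -> V} := a \*: f.

Fact lin_addA : associative lin_add.
Proof. by move=> f g h; apply/linear_ext => x /=; rewrite addrA. Qed.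
Fact lin_addC : commutative lin_add.
Proof. by move=> f g; apply/linear_ext => x /=; rewrite addrC. Qed.
Fact lin_add0 : left_id lin_zero lin_add.
Proof. by move=> f; apply/linear_ext => x /=; rewrite add0r. Qed.
Fact lin_addN : left_inverse lin_zero lin_opp lin_add.
Proof. by move=> f; apply/linear_ext => x /=; rewrite addNr. Qed.
HB.instance Definition _ := GRing.isZmodule.Build {linear U -> V}
  lin_addA lin_addC lin_add0 lin_addN.

Fact lin_scaleA a b f : lin_scale a (lin_scale b f) = lin_scale (a * b) f.
Proof. by apply/linear_ext => x /=; rewrite scalerA. Qed.
Fact lin_scale1 : left_id 1 lin_scale.
Proof. by move=> f; apply/linear_ext => x /=; rewrite scale1r. Qed.
Fact lin_scaleDr : right_distributive lin_scale +%R.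
Proof. by move=> a f g; apply/linear_ext => x /=; rewrite scalerDr. Qed.
Fact lin_scaleDl f : {morph lin_scale^~ f : a b / a + b}.
Proof. by move=> a b; apply/linear_ext => x /=; rewrite scalerDl. Qed.
HB.instance Definition _ := GRing.Zmodule_isLmodule.Build R {linear U -> V}
  lin_scaleA lin_scale1 lin_scaleDr lin_scaleDl.

End Hom.

Section Precomposition.
Variables (R : comNzRingType) (U U' V : lmodType R) (d : {linear U' -> U}).

Definition precomp (f : {linear U -> V}) : {linear U' -> V} := f \o d.

Fact precomp_linear : linear precomp.
Proof. by move=> a f g; apply/linear_ext. Qed.
HB.instance Definition _ := GRing.isLinear.Build R {linear U -> V}
  {linear U' -> V} *:%R precomp precomp_linear.

End Precomposition.
Arguments precomp {R U U'} V d.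

Section ScaleAt.
Variables (R : comNzRingType) (M : lmodType R) (v : M).

Definition scale_at (a : R^o) : M := (a : R) *: v.

Fact scale_at_linear : linear scale_at.
Proof. by move=> a b c; rewrite /scale_at scalerDl scalerA. Qed.
HB.instance Definition _ := GRing.isLinear.Build R R^o M *:%R scale_at
  scale_at_linear.

End ScaleAt.

Section CommutativeAlgebra.
Variable R : comNzRingType.
Implicit Types (I m : ideal R) (x : seq R).

Definition ideal_gen x : ideal R := span [set a : R^o | a \in x].

Definition noetherian : Prop :=
  forall I, exists x : seq R, ideal_gen x =i I.

Definition maximal_ideal I : Prop :=
  (1 : R) \notin I /\
  forall J : ideal R, {subset I <= J} -> (1 : R) \notin J -> J =i I.

Definition local_ring m : Prop :=
  maximal_ideal m /\ forall I, maximal_ideal I -> I =i m.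

(* P 0 < P 1 < ... < P n, a strictly increasing chain of n + 1 primes
   (a [prime_idealr] is proper) *)
Definition prime_chain n (P : nat -> prime_idealr R) : Prop :=
  forall i, (i < n)%N ->
    {subset P i <= P i.+1} /\ exists2 a, a \in P i.+1 & a \notin P i.

Definition krull_dim (d : nat) : Prop :=
  (exists P, prime_chain d P) /\
  forall n P, prime_chain n P -> (n <= d)%N.

(* dim R elements generating an ideal with radical m *)
Definition sop m x : Prop :=
  krull_dim (size x) /\
  forall a : R, a \in m <-> exists n, a ^+ n \in ideal_gen x.

Definition partial_sop m x : Prop := exists y, sop m (x ++ y).

Definition ideal_mul I (M : lmodType R) : submodClosed M :=
  span [set y | exists a : R, exists2 u : M, a \in I & y = a *: u].

Definition regular_sequence (M : lmodType R) x : Prop :=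
  (forall i, (i < size x)%N ->
     forall q : quotmod (ideal_mul (ideal_gen (take i x)) M),
       x`_i *: q = 0 -> q = 0) /\
  exists u : M, u \notin ideal_mul (ideal_gen x) M.

Definition big_CM_algebra m (B : comAlgType R) : Prop :=
  (exists b : B, b \notin ideal_mul m B) /\
  forall x, sop m x -> regular_sequence B x.

End CommutativeAlgebra.

Section Closures.
Variable R : comNzRingType.

(* The value at a module that is not finitely generated is irrelevant: all
   the axioms below are restricted to finitely generated modules. *)
Definition submod_map := forall M : lmodType R,
  submodClosed M -> submodClosed M.
Implicit Types (cl : submod_map) (m : ideal R).

Definition closure_operation cl : Prop :=
  forall M : lmodType R, fin_gen M -> forall N N' : submodClosed M,
    [/\ {subset N <= cl M N},
        cl M (cl M N) =i cl M N &
        {subset N <= N'} -> {subset cl M N <= cl M N'}].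

Definition functorial cl : Prop :=
  forall M W : lmodType R, fin_gen M -> fin_gen W ->
  forall (N : submodClosed M) (f : {linear M -> W}),
    {subset lin_image f (cl M N) <= cl W (lin_image f N)}.

Definition semi_residual cl : Prop :=
  forall M : lmodType R, fin_gen M -> forall N : submodClosed M,
    cl M N =i N -> cl (quotmod N) (zero_submod _) =i zero_submod (quotmod N).

Definition faithful_closure m cl : Prop := cl R^o m =i m.

Definition colon_capturing m cl : Prop :=
  forall (x : seq R) (y : R), partial_sop m (rcons x y) ->
  forall M : lmodType R, fin_gen M ->
  forall (f : {linear M -> quotmod (ideal_gen x)}) (v : M),
    (forall q, exists u, f u = q) -> f v = quot_pi (ideal_gen x) y ->
    forall u, u \in cl M (lin_range (scale_at v)) -> u \in lin_ker f ->
      u \in cl M (lin_image (scale_at v) (ideal_gen x)).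

Definition dietz_closure m cl : Prop :=
  [/\ closure_operation cl, functorial cl, semi_residual cl,
      faithful_closure m cl & colon_capturing m cl].

Definition projective (P : lmodType R) : Prop :=
  forall (U V : lmodType R) (g : {linear U -> V}) (f : {linear P -> V}),
    (forall v, exists u, g u = v) ->
    exists h : {linear P -> U}, forall x, g (h x) = f x.

Record proj_resolution (Q : lmodType R) := ProjResolution {
  res_mod : nat -> lmodType R;
  res_diff : forall n, {linear res_mod n.+1 -> res_mod n};
  res_aug : {linear res_mod 0%N -> Q};
  res_fin_gen : forall n, fin_gen (res_mod n);
  res_projective : forall n, projective (res_mod n);
  res_aug_surj : forall q, exists x, res_aug x = q;
  res_exact0 : lin_ker res_aug =i lin_range (res_diff 0);
  res_exact : forall n,
    lin_ker (res_diff n) =i lin_range (res_diff n.+1) }.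

Section Phantom.
Variables (M : lmodType R) (alpha : {linear R^o -> M}).

Definition coker : Type := quotmod (lin_range alpha).
HB.instance Definition _ := GRing.Lmodule.on coker.

(* phi is a cocycle representing the class in Ext^1(coker alpha, R) of
   0 -> R -> M -> coker alpha -> 0: it comes from a lift of the identity of
   coker alpha to a map from the resolution to this extension.  The opposite
   sign convention gives - phi, which lies in the same submodules. *)
Definition represents_extension (P : proj_resolution coker)
    (phi : {linear res_mod P 1 -> R^o}) : Prop :=
  exists2 g : {linear res_mod P 0 -> M},
    forall x, quot_pi _ (g x) = res_aug P x &
    forall y, alpha (phi y) = g (res_diff P 0 y).

(* "epsilon lies in the closure of 0 in Ext^1" read on cochains: the closure
   is that of the image of Hom(P_0, R), taken in Hom(P_1, R) *)
Definition phantom cl : Prop :=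
  injective alpha /\
  forall (P : proj_resolution coker) (phi : {linear res_mod P 1 -> R^o}),
    represents_extension phi ->
    phi \in cl {linear res_mod P 1 -> R^o}
              (lin_range (precomp R^o (res_diff P 0))).

End Phantom.

Definition algebra_axiom cl : Prop :=
  forall M : lmodType R, fin_gen M -> forall e : M,
    phantom (scale_at e) cl -> phantom (scale_at (sym2_mul e e)) cl.

End Closures.

Section AlgebraClosure.
Variables (R : comNzRingType) (B : comAlgType R).

Definition alg_closure_pred (M : lmodType R) (N : submodClosed M) : {pred M} :=
  fun u => tens (1 : B) u \in lin_range (tensor_mapr B (submod_incl N)).

Lemma alg_closure_closed M N : subsemimod_closed (@alg_closure_pred M N).
Proof.
have [_ Dr _ Zr] := tens_bilinear B M.
have t0 : tens (1 : B) (0 : M) = 0 by rewrite -[X in tens _ X](scale0r 0) Zr scale0r.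
split; first split.
- by rewrite -topredE /= /alg_closure_pred t0 rpred0.
- move=> u v; rewrite -!topredE /= /alg_closure_pred => uN vN.
  by rewrite Dr rpredD.
- move=> a u; rewrite -!topredE /= /alg_closure_pred => uN.
  by rewrite Zr rpredZ.
Qed.
HB.instance Definition _ M N := GRing.isSubmodClosed.Build R M
  (@alg_closure_pred M N) (@alg_closure_closed M N).

Definition alg_closure : submod_map R :=
  fun M N => @alg_closure_pred M N.

End AlgebraClosure.
Arguments alg_closure {R} B M N.

(* Main.v *)
From HB Require Import structures.
From mathcomp Require Import all_boot all_algebra.
From mathcomp Require Import generic_quotient freeg.
From mathcomp Require Import boolp classical_sets.
(* Last, so that [span] is the submodule spanned by a set of elements. *)
Require Import Defs.

(** Everything rests on one description of the closure ([alg_closureP]): [u]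
    lies in the closure of [N] in [M] iff [1 (x) u] lies in the submodule of
    [B (x) M] spanned by the [b (x) n] with [n] in [N].

    Dietz axioms.  The closure axioms and functoriality are read off this
    description.  Semi-residuality is right exactness of the tensor product
    ([tensor_right_exact]).  The closure of the maximal ideal [m] is an ideal
    containing [m]; it is proper because [mB <> B], so it is [m].  For
    colon-capturing, [u] in the closure of [Rv] means [1 (x) u = b (x) v] for
    some [b] in [B]; applying [f] gives [b (x) y = 0] in [B (x) R/J], that is,
    [y b] lies in [JB].  Now [y] is a nonzerodivisor on [B/JB], because systems
    of parameters are regular sequences on [B], so [b] lies in [JB] and
    [b (x) v] is in the image of [B (x) Jv].

    Algebra Axiom.  An injective map [R -> M], [1 |-> e], is phantom for the
    closure iff some linear [sigma : M -> B] has [sigma e = 1]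
    ([phantom_retraction], [retraction_phantom]).  Let [phi : P_1 -> R] be a
    cocycle and [g : P_0 -> M] the lift defining it, so that
    [phi y *: e = g (d y)].  If [phi] is in the closure of the maps factoring
    through [d : P_1 -> P_0], then [phi] becomes [psi \o d] after composition
    with [R -> B], for a linear [psi : P_0 -> B], and
    [sigma (g p + r e) = psi p + r] is well defined since the kernel of
    [P_0 -> M / Re] is the image of [d]; a resolution to start from exists
    because [R] is Noetherian ([noetherian_resolution]).  Conversely, given
    [sigma], expanding [psi = sigma \o g] along dual bases of [P_0] and [P_1]
    shows that [phi] is in the closure.

    Given [sigma] for [e], the map [x y |-> sigma x * sigma y] on the symmetric
    square sends [e e] to [1].  The map [1 |-> e e] is injective because over a
    domain some linear form [lambda : M -> R] has [lambda e != 0], and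
    [x y |-> lambda x * lambda y] sends [e e] to a nonzero element. *)

Set Implicit Arguments.
Unset Strict Implicit.
Unset Printing Implicit Defensive.

Import GRing.Theory.
Local Open Scope ring_scope.

(** * Linear maps and spans *)

Lemma linear_of (R : comNzRingType) (U V : lmodType R) (f : U -> V) :
  linear f -> exists g : {linear U -> V}, g =1 f.
Proof.
move=> fl.
pose g : {linear U -> V} := HB.pack f (GRing.isLinear.Build R U V *:%R f fl).
by exists g.
Qed.

(** A total linear relation [G] with [G 0 y -> y = 0] is the graph of a linear
    map. *)
Lemma linear_of_graph (R : comNzRingType) (U V : lmodType R)
    (G : U -> V -> Prop) :
  (forall x, exists y, G x y) ->
  (forall a x x' y y', G x y -> G x' y' -> G (a *: x + x') (a *: y + y')) ->
  (forall y, G 0 y -> y = 0) ->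
  exists2 f : {linear U -> V}, forall x, G x (f x) &
    forall x y, G x y -> f x = y.
Proof.
move=> /choice[f Gf] GP G0.
have G_fun x y y' : G x y -> G x y' -> y = y'.
  move=> Gy Gy'; apply/eqP; rewrite -subr_eq0 addrC -scaleN1r; apply/eqP/G0.
  by rewrite -(addNr x) -scaleN1r; apply: GP.
have [|g gE] := @linear_of R U V f; last first.
  by exists g => [x|x y]; rewrite gE//; exact: G_fun.
by move=> a x y; apply: (G_fun (a *: x + y)); last exact: GP.
Qed.

Lemma submod_of_pred (R : comNzRingType) (M : lmodType R) (P : M -> Prop) :
  P 0 -> (forall x y, P x -> P y -> P (x + y)) ->
  (forall a x, P x -> P (a *: x)) ->
  exists N : submodClosed M, forall x, x \in N <-> P x.
Proof.
move=> P0 PD PZ; pose Q : {pred M} := fun y => `[< P y >].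
have Qc : subsemimod_closed Q.
  split; first split.
  - exact/asboolP.
  - by move=> y z /asboolP Py /asboolP Pz; apply/asboolP/PD.
  - by move=> a y /asboolP Py; apply/asboolP/PZ.
pose N : submodClosed M := HB.pack Q (GRing.isSubmodClosed.Build R M Q Qc).
by exists N => x; split => /asboolP.
Qed.

Lemma span_ind (R : comNzRingType) (M : lmodType R) (A : set M)
    (P : M -> Prop) :
  P 0 -> (forall x y, P x -> P y -> P (x + y)) ->
  (forall a x, P x -> P (a *: x)) -> (forall x, A x -> P x) ->
  forall x, x \in span A -> P x.
Proof.
move=> P0 PD PZ AP x /asboolP xA.
have [N NP] := submod_of_pred P0 PD PZ.
by apply/NP/xA => y /AP /NP.
Qed.

Lemma mem_span (R : comNzRingType) (M : lmodType R) (A : set M) x :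
  A x -> x \in span A.
Proof. by move=> Ax; apply/asboolP => N; apply. Qed.

Lemma span_sub (R : comNzRingType) (M : lmodType R) (A : set M)
    (N : submodClosed M) :
  (forall x, A x -> x \in N) -> {subset span A <= N}.
Proof. by move=> AN x /asboolP; apply. Qed.

Lemma quot_pi_eq0 (R : comNzRingType) (M : lmodType R) (N : submodClosed M) x :
  quot_pi N x = 0 <-> x \in N.
Proof.
by rewrite -{2}(subr0 x) -quot_pi_eq raddf0; split=> [->|/eqP].
Qed.

Lemma span_linear_sub (R : comNzRingType) (U V : lmodType R)
    (f : {linear U -> V}) (A : set U) (N : submodClosed V) :
  (forall x, A x -> f x \in N) -> forall x, x \in span A -> f x \in N.
Proof.
move=> AN; apply: span_ind => [|x y xN yN|a x xN|//].
- by rewrite raddf0 rpred0.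
- by rewrite raddfD rpredD.
- by rewrite linearZZ rpredZ.
Qed.

(** * Tensor products *)

Lemma tensor_ind (R : comNzRingType) (M N : lmodType R)
    (P : tensor M N -> Prop) :
  P 0 -> (forall x y, P x -> P y -> P (x + y)) ->
  (forall a x, P x -> P (a *: x)) -> (forall x y, P (tens x y)) ->
  forall t, P t.
Proof.
move=> P0 PD PZ Pt q; have [t <-] := quot_pi_surj q.
rewrite -(freeg_sumE t) raddf_sum; apply: big_ind => // -[x y] _.
set k := coeff _ _.
have -> : << k *g (x, y) >> = k *: pre_tens x y :> pre_tensor M N.
  apply/eqP/freeg_eqP => z.
  by rewrite [_ *: _]/(fgscale _ _) coeff_fgscale !coeffU mul1r.
have E : quot_pi (span (@tensor_rel R M N)) (k *: pre_tens x y) =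
    k *: tens x y.
  exact: quot_piZ.
by have := PZ k _ (Pt x y); rewrite -E.
Qed.

Section TensorLinear.
Variables (R : comNzRingType) (M N : lmodType R).

Lemma tens_linearr (x : M) : linear (@tens R M N x).
Proof.
by have [_ Dr _ Zr] := tens_bilinear M N; move=> a y z; rewrite Dr Zr.
Qed.
HB.instance Definition _ x :=
  GRing.isLinear.Build R N (tensor M N) *:%R (@tens R M N x) (tens_linearr x).

Lemma tensDl (x x' : M) (y : N) : tens (x + x') y = tens x y + tens x' y.
Proof. by have [] := tens_bilinear M N. Qed.

Lemma tensZl a (x : M) (y : N) : tens (a *: x) y = a *: tens x y.
Proof. by have [] := tens_bilinear M N. Qed.

Lemma tens0l (y : N) : tens (0 : M) y = 0.
Proof. by rewrite -(scale0r 0) tensZl scale0r. Qed.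

Lemma tens_suml I (r : seq I) (P : pred I) (F : I -> M) (y : N) :
  tens (\sum_(i <- r | P i) F i) y = \sum_(i <- r | P i) tens (F i) y.
Proof.
elim/big_rec2: _ => [|i u v _ <-]; first exact: tens0l.
by rewrite tensDl.
Qed.

Lemma tens_scale a (x : M) (y : N) : tens (a *: x) y = tens x (a *: y).
Proof. by rewrite tensZl linearZZ. Qed.

Lemma tens_linearl (y : N) :
  exists f : {linear M -> tensor M N}, forall x, f x = tens x y.
Proof. by apply: linear_of => a x x'; rewrite tensDl tensZl. Qed.

Lemma tensor_liftP (V : lmodType R) (h : M -> N -> V) :
  (forall y, linear (h^~ y)) -> (forall x, linear (h x)) ->
  exists f : {linear tensor M N -> V}, forall x y, f (tens x y) = h x y.
Proof.
move=> hl hr.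
have Dl x x' y : h (x + x') y = h x y + h x' y.
  by have := hl y 1 x x'; rewrite !scale1r.
have Dr x y y' : h x (y + y') = h x y + h x y'.
  by have := hr x 1 y y'; rewrite !scale1r.
have l0 y : h 0 y = 0 by apply: (addrI (h 0 y)); rewrite -Dl !addr0.
have r0 x : h x 0 = 0 by apply: (addrI (h x 0)); rewrite -Dr !addr0.
have Zl a x y : h (a *: x) y = a *: h x y.
  by have := hl y a x 0; rewrite !addr0 l0 addr0.
have Zr a x y : h x (a *: y) = a *: h x y.
  by have := hr x a y 0; rewrite !addr0 r0 addr0.
have [f fE] := linear_of (tensor_lift_linear Dl Dr Zl Zr).
by exists f => x y; rewrite fE tensor_lift_tens.
Qed.

End TensorLinear.

Section RightExactness.
Variables (R : comNzRingType) (M N : lmodType R).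

(** The tensors [x (x) y] with [y] in [S]; their span is the image of
    [M (x) S -> M (x) N]. *)
Definition pure_tensors (S : submodClosed N) : set (tensor M N) :=
  [set t | exists x, exists2 y, y \in S & t = tens x y].

(** The map [M (x) N / S -> (M (x) N) / T], with [T] the span of the pure
    tensors over [S], is induced by [x (x) pi y |-> x (x) y]. *)
Lemma tensor_right_exact (S : submodClosed N) t :
  tensor_mapr M (quot_pi S) t = 0 -> t \in span (pure_tensors S).
Proof.
pose T := span (pure_tensors S).
pose h x (q : quotmod S) : quotmod T :=
  quot_pi T (tens x (repr (q : Quotient.quot _))).
have hE x y : h x (quot_pi S y) = quot_pi T (tens x y).
  apply/eqP; rewrite /h quot_pi_eq -raddfB mem_span//.
  exists x, (repr (quot_pi S y : Quotient.quot _) - y) => //.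
  by rewrite -quot_pi_eq {1}/quot_pi reprK.
have hl q : linear (h^~ q).
  by move=> a x y; rewrite /h tensDl tensZl linearP.
have hrN x := @tens_linearr R M N x.
have hr x : linear (h x).
  move=> a p q; have [y <-] := quot_pi_surj p; have [z <-] := quot_pi_surj q.
  by rewrite -linearP !hE hrN linearP.
have [f fE] := tensor_liftP hl hr.
have ft : forall u, f (tensor_mapr M (quot_pi S) u) = quot_pi T u.
  apply: tensor_ind => [|u v uE vE|a u uE|x y]; rewrite ?raddf0//.
  - by rewrite !raddfD /= uE vE.
  - by rewrite !linearZZ /= uE.
  - by rewrite tensor_mapr_tens fE hE.
move=> t0; have := ft t; rewrite t0 raddf0 => /esym.
by move/quot_pi_eq0.
Qed.

End RightExactness.

Arguments pure_tensors {R} M {N} S _.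

(** * The algebra closure is a Dietz closure *)

Section AlgebraClosureTheory.
Variables (R : comNzRingType) (B : comAlgType R).

Lemma alg_closureE (M : lmodType R) (N : submodClosed M) u :
  (u \in alg_closure B M N) =
    (tens (1 : B) u \in lin_range (tensor_mapr B (submod_incl N))).
Proof. by []. Qed.

Lemma alg_closureP (M : lmodType R) (N : submodClosed M) u :
  u \in alg_closure B M N <-> tens (1 : B) u \in span (pure_tensors B N).
Proof.
rewrite alg_closureE; split=> [/asboolP[t <-]|].
  elim/tensor_ind: t => [|s t sN tN|a t tN|b y].
  - by rewrite raddf0 rpred0.
  - by rewrite raddfD rpredD.
  - by rewrite linearZZ rpredZ.
  - rewrite /= tensor_mapr_tens mem_span//; exists b, (submod_incl N y) => //.
    exact: (valP y).
apply: span_sub => _ [b [y yN ->]]; apply/asboolP.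
by exists (tens b (exist _ y yN : submod N)); rewrite /= tensor_mapr_tens.
Qed.

Lemma tens_mull (M : lmodType R) (b : B) :
  exists f : {linear tensor B M -> tensor B M},
    forall c u, f (tens c u) = tens (b * c) u.
Proof.
apply: tensor_liftP => [u a c c'|c a u u'].
  by rewrite mulrDr -scalerAr tensDl tensZl.
by rewrite linearP.
Qed.

(** The span in [alg_closureP] is stable under multiplication by [B]; this gives
    idempotence of the closure. *)
Lemma alg_closure_tens (M : lmodType R) (N : submodClosed M) (b : B) u :
  u \in alg_closure B M N -> tens b u \in span (pure_tensors B N).
Proof.
have [f fE] := tens_mull M b.
move=> /alg_closureP uN; rewrite -(mulr1 b) -fE.
apply: span_linear_sub uN => _ [c [y yN ->]].
by rewrite fE mem_span//; exists (b * c), y.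
Qed.

Lemma alg_closure_closure : closure_operation (alg_closure B).
Proof.
move=> M _ N N'.
have sub (K : submodClosed M) : {subset K <= alg_closure B M K}.
  by move=> u uK; apply/alg_closureP/mem_span; exists 1, u.
split=> // [u|NN' u /alg_closureP uN].
  apply/idP/idP => [/alg_closureP uN|]; last exact: sub.
  apply/alg_closureP; apply: span_sub uN => _ [b [y yN ->]].
  exact: alg_closure_tens.
apply/alg_closureP; apply: span_sub uN => _ [b [y /NN' yN ->]].
by apply: mem_span; exists b, y.
Qed.

Lemma alg_closure_functorial : functorial (alg_closure B).
Proof.
move=> M W _ _ N f _ /asboolP[u /alg_closureP uN <-].
apply/alg_closureP; rewrite -tensor_mapr_tens.
apply: span_linear_sub uN => _ [c [y yN ->]].
rewrite /= tensor_mapr_tens mem_span//; exists c, (f y) => //.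
by apply/asboolP; exists y.
Qed.

Lemma alg_closure_semi_residual : semi_residual (alg_closure B).
Proof.
move=> M _ N clN q; apply/idP/idP; last first.
  by move=> /eqP->; rewrite rpred0.
have [u <-] := quot_pi_surj q.
move=> /alg_closureP uN; have {uN} : tens (1 : B) (quot_pi N u) = 0.
  move: (tens 1 _) uN.
  apply: span_ind => [|s t -> ->|a t ->|_ [c [y /eqP-> ->]]] //.
  - by rewrite addr0.
  - by rewrite scaler0.
  - by rewrite raddf0.
rewrite -tensor_mapr_tens => /tensor_right_exact/alg_closureP.
by rewrite clN => uN; apply/eqP/quot_pi_eq0.
Qed.

Lemma tens_regular :
  exists f : {linear tensor B R^o -> B},
    forall b a, f (tens b a) = (a : R) *: b.
Proof.
apply: (@tensor_liftP _ B R^o B (fun b a => (a : R) *: b)).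
  by move=> a c b b'; rewrite scalerDr !scalerA mulrC.
by move=> b c a a'; rewrite scalerDl scalerA.
Qed.

Lemma tens_ideal_mul (I : ideal R) (b : B) (a : R^o) :
  tens b a \in span (pure_tensors B I) -> (a : R) *: b \in ideal_mul I B.
Proof.
have [f fE] := tens_regular.
rewrite -fE; apply: span_linear_sub => _ [c [y yN ->]].
by rewrite fE mem_span//; exists y, c.
Qed.

(** The extension of [I] to [B] is stable under multiplication by [B]. *)
Lemma ideal_mul1 (I : ideal R) :
  (1 : B) \in ideal_mul I B -> forall b : B, b \in ideal_mul I B.
Proof.
move=> I1 b; have [f fE] : exists f : {linear B -> B}, forall c, f c = b * c.
  by apply: linear_of => a c d; rewrite mulrDr scalerAr.
rewrite -(mulr1 b) -fE; apply: span_linear_sub I1 => _ [c [y yN ->]].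
by rewrite fE -scalerAr mem_span//; exists c, (b * y).
Qed.

Lemma alg_closure_faithful (m : ideal R) :
  maximal_ideal m -> (exists b : B, b \notin ideal_mul m B) ->
  faithful_closure m (alg_closure B).
Proof.
move=> [m1 max_m] [b bm]; apply: (max_m (alg_closure B R^o m)).
  by move=> u um; apply/alg_closureP/mem_span; exists 1, u.
apply/negP => /alg_closureP /tens_ideal_mul; rewrite scale1r.
by move=> /ideal_mul1 /(_ b); exact/negP.
Qed.

Lemma alg_closure_colon_capturing (m : ideal R) :
  big_CM_algebra m B -> colon_capturing m (alg_closure B).
Proof.
move=> [_ CM] x y [z xyz] M _ f v _ fv u /alg_closureP uv u0.
have [b bE] : exists b : B, tens (1 : B) u = tens b v.
  move: (tens 1 u) uv.
  apply: span_ind => [|s t [b ->] [c ->]|a t [b ->]|_ [c [w wv ->]]].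
  - by exists 0; rewrite tens0l.
  - by exists (b + c); rewrite tensDl.
  - by exists (a *: b); rewrite tensZl.
  - move: wv => /asboolP[a <-].
    by exists ((a : R) *: c); rewrite tens_scale.
have yb : (y : R) *: b \in ideal_mul (ideal_gen x) B.
  apply: tens_ideal_mul; apply: tensor_right_exact.
  have -> : tensor_mapr B (quot_pi (ideal_gen x)) (tens b (y : R^o)) =
      tensor_mapr B f (tens b v) by rewrite !tensor_mapr_tens fv.
  by rewrite -bE tensor_mapr_tens (eqP u0) raddf0.
(* y is the term of index size x of the regular sequence rcons x y ++ z *)
have bI : b \in ideal_mul (ideal_gen x) B.
  have [reg _] := CM _ xyz.
  have := reg (size x); rewrite cat_rcons size_cat /= addnS ltnS leq_addr.
  rewrite take_size_cat// nth_cat ltnn subnn /=.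
  move=> /(_ isT (quot_pi _ b)); rewrite -linearZZ => H.
  exact/quot_pi_eq0/H/quot_pi_eq0.
have [g gE] := tens_linearl B v.
apply/alg_closureP; rewrite bE -gE.
apply: span_linear_sub bI => _ [a [c aI ->]].
rewrite gE tens_scale mem_span//; exists c, (a *: v) => //.
by apply/asboolP; exists a.
Qed.

Lemma alg_closure_dietz (m : ideal R) :
  maximal_ideal m -> big_CM_algebra m B -> dietz_closure m (alg_closure B).
Proof.
move=> max_m CM; split.
- exact: alg_closure_closure.
- exact: alg_closure_functorial.
- exact: alg_closure_semi_residual.
- by apply: alg_closure_faithful; case: CM.
- exact: alg_closure_colon_capturing.
Qed.

End AlgebraClosureTheory.

(** * Finitely generated modules over Noetherian rings *)

Section Noetherian.
Variable R : comNzRingType.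
Implicit Types M U V : lmodType R.

Lemma submodB M (N : submodClosed M) x y :
  x \in N -> y \in N -> x - y \in N.
Proof. by move=> xN yN; rewrite rpredD// -scaleN1r rpredZ. Qed.

Lemma span_cons M (x : M) s u :
  u \in span [set` x :: s] -> exists a, u - a *: x \in span [set` s].
Proof.
move: u; apply: span_ind => [|v w [a va] [b wb]|c v [a va]|v].
- by exists 0; rewrite scale0r subr0 rpred0.
- by exists (a + b); rewrite scalerDl opprD addrACA rpredD.
- by exists (c * a); rewrite -scalerA -scalerBr rpredZ.
- rewrite /= inE => /orP[/eqP->|vs].
    by exists 1; rewrite scale1r subrr rpred0.
  by exists 0; rewrite scale0r subr0 mem_span.
Qed.

(** Induction on the generators [x :: s]: the coefficients of [x] in elements
    of [N] form an ideal [I].  Lifts to [N] of generators of [I] generate [N]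
    together with generators of the intersection of [N] with the span of [s]. *)
Lemma noetherian_submod M (s : seq M) (N : submodClosed M) :
  noetherian R -> {subset N <= span [set` s]} ->
  exists t : seq M, span [set` t] =i N.
Proof.
move=> noeth; elim: s N => [|x s IHs] N Ns.
  exists [::] => u; apply/idP/idP => [|/Ns//].
  by apply: span_sub.
pose P (a : R^o) := exists2 y, y \in span [set` s] & (a : R) *: x + y \in N.
have [I IP] : exists I : ideal R, forall a, a \in I <-> P a.
  apply: submod_of_pred => [|a b [y ys ay] [z zs bz]|c a [y ys ay]].
  - by exists 0; rewrite ?rpred0// scale0r addr0 rpred0.
  - exists (y + z); first exact: rpredD.
    by rewrite scalerDl addrACA rpredD.
  - exists (c *: y); first exact: rpredZ.
    by rewrite -scalerA -scalerDr rpredZ.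
have [gI gE] := noeth I.
have h_ex (a : R^o) : exists y, a \in I ->
    y \in span [set` s] /\ (a : R) *: x + y \in N.
  have [/IP[y ys ay]|aI] := boolP (a \in I); first by exists y.
  by exists 0.
have [h hP] := choice h_ex.
have [N' N'P] : exists N' : submodClosed M, forall u,
    u \in N' <-> u \in N /\ u \in span [set` s].
  apply: submod_of_pred => [|u v [uN us] [vN vs]|c u [uN us]].
  - by rewrite !rpred0.
  - by rewrite !rpredD.
  - by rewrite !rpredZ.
have [|t tE] := IHs N'; first by move=> u /N'P[].
pose T := [seq a *: x + h a | a <- gI] ++ t.
have gI_I a : a \in gI -> (a : R^o) \in I by move=> ag; rewrite -gE mem_span.
have TN : {subset span [set` T] <= N}.
  apply: span_sub => u /=; rewrite mem_cat => /orP[/mapP[a /gI_I aI ->]|ut].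
    by case: (hP a aI).
  have : u \in span [set` t] by rewrite mem_span.
  by rewrite tE => /N'P[].
exists T => u; apply/idP/idP => [/TN//|uN].
have [a ua] := span_cons (Ns _ uN).
have aI : (a : R^o) \in I.
  by apply/IP; exists (u - a *: x) => //; rewrite addrC subrK.
have [w wT wa] : exists2 w, w \in span [set` T] & w - a *: x \in span [set` s].
  move: aI; rewrite -gE; move: (a : R^o).
  apply: span_ind => [|b c [v vT vb] [w wT wc]|c b [v vT vb]|b bg].
  - by exists 0; rewrite ?scale0r ?subr0 rpred0.
  - exists (v + w); first exact: rpredD.
    by rewrite scalerDl opprD addrACA rpredD.
  - exists (c *: v); first exact: rpredZ.
    by rewrite -scalerA -scalerBr rpredZ.
  - exists (b *: x + h b); last first.
      by rewrite addrAC subrr add0r; case: (hP b (gI_I _ bg)).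
    apply: mem_span; rewrite /= mem_cat; apply/orP; left.
    by apply/mapP; exists b.
rewrite -(subrK w u) rpredD//.
have : u - w \in N'.
  apply/N'P; split; first by rewrite submodB// TN.
  have -> : u - w = (u - a *: x) - (w - a *: x) by rewrite opprB addrA subrK.
  by rewrite submodB.
rewrite -tE; apply: span_sub => v /= vt.
by rewrite mem_span//= mem_cat vt orbT.
Qed.

Lemma row_linear n V (e : 'I_n -> V) :
  exists f : {linear 'rV[R]_n -> V}, forall v, f v = \sum_i v 0 i *: e i.
Proof.
apply: linear_of => a u v; rewrite scaler_sumr -big_split /=.
by apply: eq_bigr => i _; rewrite !mxE scalerDl scalerA.
Qed.

Lemma fin_gen_row n : fin_gen 'rV[R]_n.
Proof.
exists [seq delta_mx 0 i | i : 'I_n] => v; rewrite (row_sum_delta v).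
apply: rpred_sum => i _; rewrite rpredZ// mem_span//=.
by rewrite map_f// mem_enum.
Qed.

Lemma projective_row n : projective 'rV[R]_n.
Proof.
move=> U V g f /(_ (f (delta_mx 0 _)))-surj.
have [e eP] := choice surj.
have [h hE] := row_linear e; exists h => v.
rewrite hE linear_sum [in RHS](row_sum_delta v) linear_sum.
by apply: eq_bigr => i _; rewrite !linearZZ eP.
Qed.

Lemma span_range M (s : seq M) :
  exists f : {linear 'rV[R]_(size s) -> M}, lin_range f =i span [set` s].
Proof.
have [f fE] := row_linear (fun i : 'I_(size s) => s`_i).
exists f => u; apply/idP/idP => [/asboolP[v <-]|].
  rewrite fE; apply: rpred_sum => i _.
  by rewrite rpredZ// mem_span//= mem_nth.
apply: span_sub => x /= xs.
have xi : (index x s < size s)%N by rewrite index_mem.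
apply/asboolP; exists (delta_mx 0 (Ordinal xi)).
rewrite fE (bigD1 (Ordinal xi))//= big1 => [|j /negPf jx].
  by rewrite mxE !eqxx scale1r addr0 nth_index.
by rewrite mxE jx andbF scale0r.
Qed.

Lemma fin_gen_cover M : fin_gen M ->
  exists n, exists f : {linear 'rV[R]_n -> M}, forall x, exists v, f v = x.
Proof.
move=> [s sM]; have [f fE] := span_range s.
by exists (size s), f => x; apply/asboolP; move: (sM x); rewrite -fE.
Qed.

Lemma fin_gen_quot M (N : submodClosed M) : fin_gen M -> fin_gen (quotmod N).
Proof.
move=> [s sM]; exists (map (quot_pi N) s) => q; have [x <-] := quot_pi_surj q.
move: (sM x); apply: span_linear_sub => y ys; apply: mem_span.
by rewrite /= map_f.
Qed.

Lemma noetherian_resolution (Q : lmodType R) :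
  noetherian R -> fin_gen Q -> inhabited (proj_resolution Q).
Proof.
move=> noeth /fin_gen_cover[n0 [aug aug_surj]].
(* A state is a rank together with the next kernel to be covered. *)
pose T := {n & submodClosed 'rV[R]_n}.
have step (k : T) : {l : {n & {linear 'rV[R]_n -> 'rV[R]_(projT1 k)}} |
    lin_range (projT2 l) =i projT2 k}.
  apply: cid; have [s sM] := fin_gen_row (projT1 k).
  have [t tE] := noetherian_submod noeth (N := projT2 k) (fun x _ => sM x).
  have [f fE] := span_range t.
  by exists (existT _ (size t) f) => x; rewrite /= fE tE.
pose next (k : T) : T :=
  existT (fun n => submodClosed 'rV[R]_n) (projT1 (sval (step k)))
    (lin_ker (projT2 (sval (step k))) : submodClosed _).
pose st i : T := iter i next
  (existT (fun n => submodClosed 'rV[R]_n) n0 (lin_ker aug : submodClosed _)).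
constructor; apply: (@ProjResolution R Q (fun i => 'rV[R]_(projT1 (st i)))
  (fun i => projT2 (sval (step (st i)))) aug) => //.
- by move=> n; exact: fin_gen_row.
- by move=> n; exact: projective_row.
- by move=> x; rewrite (svalP (step (st 0%N)) x).
- by move=> n x; rewrite (svalP (step (st n.+1)) x).
Qed.

(** Coordinates on a finitely generated projective module, taken from a
    section of a surjection from a free module. *)
Lemma dual_basis (P : lmodType R) : projective P -> fin_gen P ->
  exists n (p : 'I_n -> P) (p' : 'I_n -> {linear P -> R^o}),
    forall x, x = \sum_i (p' i x : R) *: p i.
Proof.
move=> projP /fin_gen_cover[n [f f_surj]].
have [h fh] := projP _ _ f (idfun : {linear P -> P}) f_surj.
have coord i : exists g : {linear P -> R^o}, forall x, g x = h x 0 i.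
  by apply: linear_of => a x y; rewrite linearP !mxE.
have [p' p'E] := choice coord.
exists n, (fun i => f (delta_mx 0 i)), p' => x.
rewrite -[LHS]/(idfun x) -fh [h x]row_sum_delta linear_sum.
by apply: eq_bigr => i _; rewrite linearZZ p'E.
Qed.

End Noetherian.

(** * Phantom maps and retractions to the algebra *)

Section PhantomRetraction.
Variables (R : comNzRingType) (B : comAlgType R).
Implicit Types (M : lmodType R).

Lemma scale_atE M (e : M) (a : R) : scale_at e a = a *: e.
Proof. by []. Qed.

Lemma lin_hom_sum (U V : lmodType R) I (r : seq I)
    (F : I -> {linear U -> V}) x :
  (\sum_(i <- r) F i) x = \sum_(i <- r) F i x.
Proof. by elim/big_rec2: _ => [|i u f _ <-]. Qed.

(** Evaluation at [x], as a map [B (x) Hom(U, R) -> B]. *)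
Lemma tensor_eval (U : lmodType R) (x : U) :
  exists f : {linear tensor B {linear U -> R^o} -> B},
    forall b (chi : {linear U -> R^o}), f (tens b chi) = (chi x : R) *: b.
Proof.
apply: (@tensor_liftP _ _ _ _
  (fun b (chi : {linear U -> R^o}) => (chi x : R) *: b)).
  by move=> chi a b b'; rewrite scalerDr !scalerA mulrC.
by move=> b a chi chi' /=; rewrite scalerDl scalerA.
Qed.

(** If [phi] lies in the closure of the functionals factoring through [d], then
    it factors through [d] once its values are taken in [B]. *)
Lemma alg_closure_precomp (U U' : lmodType R) (d : {linear U' -> U})
    (phi : {linear U' -> R^o}) :
  phi \in alg_closure B {linear U' -> R^o} (lin_range (precomp R^o d)) ->
  exists psi : {linear U -> B}, forall y, psi (d y) = (phi y : R) *: 1.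
Proof.
have [ev evE] := choice (@tensor_eval U').
pose P t := exists psi : {linear U -> B}, forall y, psi (d y) = ev y t.
move=> /alg_closureP phi_cl.
have [psi psiE] : P (tens 1 phi).
  move: phi_cl; set A := pure_tensors _ _.
  apply: (@span_ind R (tensor B {linear U' -> R^o}) A P) =>
    [|s t [p sp] [q tq]|a t [q tq]|].
  - by exists \0 => y; rewrite raddf0.
  - by exists (p \+ q) => y; rewrite raddfD /= -sp -tq.
  - by exists (a \*: q) => y; rewrite linearZZ /= -tq.
  - move=> _ [b [_ /asboolP[theta <-] ->]].
    have [p pE] : exists p : {linear U -> B},
        forall x, p x = (theta x : R) *: b.
      by apply: linear_of => a x y; rewrite linearP scalerDl scalerA.
    by exists p => y; rewrite pE evE.
by exists psi => y; rewrite psiE evE.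
Qed.

Lemma phantom_retraction M (e : M) :
  noetherian R -> fin_gen M -> phantom (scale_at e) (alg_closure B) ->
  exists sigma : {linear M -> B}, sigma e = 1.
Proof.
move=> noeth fgM [inj_e ph].
have [P] : inhabited (proj_resolution (coker (scale_at e))).
  exact/noetherian_resolution/fin_gen_quot.
pose d := res_diff P 0.
have [g gP] := @res_projective _ _ P 0%N _ _
  (quot_pi (lin_range (scale_at e))) (res_aug P) (@quot_pi_surj _ _ _).
(* phi y is the coefficient of e in g (d y), which lies in Re *)
have [phi phiP _] : exists2 phi : {linear res_mod P 1 -> R^o},
    forall y, (phi y : R) *: e = g (d y) &
    forall y a, (a : R) *: e = g (d y) -> phi y = a.
  apply: (linear_of_graph (G := fun y (a : R^o) => (a : R) *: e = g (d y))).
  - move=> y; apply/asboolP.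
    suff : g (d y) \in lin_range (scale_at e) by [].
    apply/quot_pi_eq0; rewrite gP; apply/eqP.
    suff : d y \in lin_ker (res_aug P) by [].
    by rewrite res_exact0; apply/asboolP; exists y.
  - move=> a y y' b b' yb yb'.
    by rewrite scalerDl -scalerA yb yb' !linearP.
  - move=> a; rewrite !raddf0 => ae; apply: inj_e.
    by rewrite raddf0.
have phi_cl := ph P phi (ex_intro2 _ _ g gP phiP).
have [psi psiP] := alg_closure_precomp phi_cl.
have [sigma _ sigmaP] : exists2 sigma : {linear M -> B},
    forall x, exists p (r : R), x = g p + r *: e /\ sigma x = psi p + r *: 1 &
    forall x b, (exists p (r : R), x = g p + r *: e /\ b = psi p + r *: 1) ->
      sigma x = b.
  apply: (linear_of_graph (G := fun x b =>
    exists p (r : R), x = g p + r *: e /\ b = psi p + r *: 1)).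
  - move=> x; have [p px] := res_aug_surj P (quot_pi _ x).
    have : x - g p \in lin_range (scale_at e).
      by rewrite -quot_pi_eq gP px.
    move=> /asboolP[r rE]; exists (psi p + (r : R) *: 1), p, r; split=> //.
    by rewrite -scale_atE rE addrC subrK.
  - move=> a x x' b b' [p [r [-> ->]]] [p' [r' [-> ->]]].
    exists (a *: p + p'), (a * r + r').
    by split; rewrite linearP scalerDr scalerDl -scalerA addrACA.
  - move=> b [p [r [pr ->]]].
    have : p \in lin_ker (res_aug P).
      apply/eqP; rewrite -gP; apply/quot_pi_eq0/asboolP; exists (- r).
      by rewrite /= scale_atE scaleNr -(addrK (r *: e) (g p)) -pr sub0r.
    rewrite res_exact0 => /asboolP[y yp].
    have yr : (phi y : R) + r = 0.
      apply: inj_e; rewrite raddf0 /= scale_atE scalerDl phiP yp.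
      by rewrite -pr.
    by rewrite -yp psiP -scalerDl yr scale0r.
exists sigma; apply: sigmaP; exists 0, 1.
by rewrite !raddf0 !add0r !scale1r.
Qed.

Lemma tens_dual_basis (P : lmodType R) n (p : 'I_n -> P)
    (p' : 'I_n -> {linear P -> R^o}) (b : B) (chi : {linear P -> R^o}) :
  (forall x, x = \sum_i (p' i x : R) *: p i) ->
  tens b chi = \sum_i tens ((chi (p i) : R) *: b) (p' i).
Proof.
move=> pE; have {1}-> : chi = \sum_i (chi (p i) : R) *: p' i.
  apply: linear_ext => x; rewrite lin_hom_sum {1}(pE x) linear_sum.
  by apply: eq_bigr => i _; rewrite linearZZ /= [LHS]mulrC.
rewrite linear_sum; apply: eq_bigr => i _.
by rewrite linearZZ tensZl.
Qed.

Lemma retraction_phantom M (e : M) (sigma : {linear M -> B}) :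
  injective (scale_at e) -> sigma e = 1 ->
  phantom (scale_at e) (alg_closure B).
Proof.
move=> inj_e sigma1; split=> // P phi [g gP phiP].
have [n [p [p' pE]]] :=
  dual_basis (@res_projective _ _ P 0%N) (res_fin_gen P 0).
have [k [q [q' qE]]] :=
  dual_basis (@res_projective _ _ P 1%N) (res_fin_gen P 1).
pose d := res_diff P 0; pose psi x : B := sigma (g x).
apply/alg_closureP.
(* both sides are expanded along the dual basis q, q' of P_1 *)
have -> : tens (1 : B) phi = \sum_i tens (psi (p i)) (precomp R^o d (p' i)).
  rewrite (tens_dual_basis 1 phi qE).
  under [RHS]eq_bigr => i _ do rewrite (tens_dual_basis _ _ qE).
  rewrite exchange_big; apply: eq_bigr => j _ /=.
  rewrite -tens_suml; congr (tens _ _).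
  have phi_q : (phi (q j) : R) *: e = g (d (q j)) := phiP (q j).
  rewrite -sigma1 -linearZZ phi_q {1}(pE (d (q j))) !linear_sum.
  by apply: eq_bigr => i _; rewrite !linearZZ.
apply: rpred_sum => i _; apply: mem_span.
exists (psi (p i)), (precomp R^o d (p' i)) => //.
by apply/asboolP; exists (p' i).
Qed.

End PhantomRetraction.

(** * The symmetric square and the Algebra Axiom *)

Section SymmetricSquare.
Variables (R : comNzRingType) (M : lmodType R).

(** The square of a linear map to a commutative algebra. *)
Lemma sym2_square (A : comAlgType R) (f : {linear M -> A}) :
  exists g : {linear sym2 M -> A}, forall x y, g (sym2_mul x y) = f x * f y.
Proof.
have [h hE] : exists h : {linear tensor M M -> A},
    forall x y, h (tens x y) = f x * f y.
  apply: (@tensor_liftP _ _ _ _ (fun x y => f x * f y)) => [y a x x'|x a y y'].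
    by rewrite linearP mulrDl scalerAl.
  by rewrite linearP mulrDr scalerAr.
have h0 : forall t, t \in span (@sym2_rel R M) -> h t = 0.
  move=> t tS; apply/eqP; move: t tS.
  apply: (@span_sub _ _ _ (lin_ker h)) => _ [x [y ->]].
  by rewrite -topredE /= /lin_ker raddfB /= !hE mulrC subrr.
have [|g gE] := @linear_of _ (sym2 M) A (quot_lift h).
  move=> a s t; have [x <-] := quot_pi_surj s; have [y <-] := quot_pi_surj t.
  by rewrite -linearP !quot_liftE// linearP.
by exists g => x y; rewrite gE /sym2_mul quot_liftE.
Qed.

End SymmetricSquare.

Section Functional.
Variable R : idomainType.

(** Generators of [M] are killed one by one, except those with a nonzero
    multiple that is already a multiple of [e].  The result is [pi : M -> V]
    with [pi e] torsion-free, and [a != 0] such that every [a *: pi x] is a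
    multiple of [pi e]; the coefficient is the required linear form. *)
Lemma nonzero_functional (M : lmodType R) (e : M) :
  fin_gen M -> injective (scale_at e) ->
  exists lambda : {linear M -> R^o}, lambda e != 0.
Proof.
move=> [s sM] inj_e.
have e0 a : a *: e = 0 -> a = 0.
  by move=> ae; apply: inj_e; rewrite raddf0.
have [V [pi [a [a0 pi0 piE]]]] : exists (V : lmodType R)
    (pi : {linear M -> V}) (a : R),
    [/\ a != 0, forall r : R, r *: pi e = 0 -> r = 0 &
        forall x, x \in s -> exists r : R, a *: pi x = r *: pi e].
  elim: (s) => [|x t [V [pi [a [a0 pi0 piE]]]]].
    by exists M, idfun, 1; split; rewrite ?oner_neq0.
  have [[c [r [c0 cr]]]|H] :=
      pselect (exists c r : R, c != 0 /\ c *: pi x = r *: pi e).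
    exists V, pi, (a * c); split=> // [|y]; first by rewrite mulf_neq0.
    rewrite inE => /orP[/eqP->|/piE[b bE]].
      by exists (a * r); rewrite -!scalerA cr.
    by exists (c * b); rewrite mulrC -!scalerA bE.
  pose K := lin_range (scale_at (pi x)).
  exists (quotmod K), (quot_pi K \o pi), a; split=> // [r re|y].
    have : r *: pi e \in K.
      by apply/quot_pi_eq0; rewrite -re linearZZ.
    move=> /asboolP[c cE].
    have [c0|c0] := eqVneq (c : R) 0.
      by apply: pi0; rewrite -cE /= scale_atE c0 scale0r.
    by case: H; exists c, r.
  rewrite inE => /orP[/eqP->|/piE[b bE]].
    exists 0; rewrite scale0r /= -linearZZ.
    by apply/quot_pi_eq0/asboolP; exists a.
  by exists b; have /(congr1 (quot_pi K)) := bE; rewrite !linearZZ.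
have [lambda _ lambdaP] : exists2 lambda : {linear M -> R^o},
    forall x, a *: pi x = (lambda x : R) *: pi e &
    forall x r, a *: pi x = (r : R) *: pi e -> lambda x = r.
  apply: (linear_of_graph
    (G := fun x (r : R^o) => a *: pi x = (r : R) *: pi e)).
  - move=> x; move: x (sM x).
    apply: span_ind => [|x y [b bE] [c cE]|c x [b bE]|x /piE//].
    + by exists 0; rewrite raddf0 scaler0 scale0r.
    + by exists (b + c); rewrite raddfD scalerDr bE cE scalerDl.
    + by exists (c * b); rewrite linearZZ scalerA mulrC -scalerA bE scalerA.
  - move=> c x x' r r' xr xr'.
    by rewrite linearP scalerDr scalerA mulrC -scalerA xr xr' scalerDl scalerA.
  - by move=> r; rewrite raddf0 scaler0 => /esym /pi0.
by exists lambda; rewrite (lambdaP e a).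
Qed.

Lemma sym2_square_inj (M : lmodType R) (e : M) :
  fin_gen M -> injective (scale_at e) -> injective (scale_at (sym2_mul e e)).
Proof.
move=> fgM inj_e; have [lambda l0] := nonzero_functional fgM inj_e.
have [g gE] := sym2_square lambda.
apply: raddf_inj => a ae.
have /(congr1 g) : (a : R) *: sym2_mul e e = 0 := ae.
rewrite linearZZ gE raddf0 => /eqP.
by rewrite !mulf_eq0 (negPf l0) !orbF => /eqP.
Qed.

Lemma alg_closure_algebra_axiom (B : comAlgType R) :
  noetherian R -> algebra_axiom (alg_closure B).
Proof.
move=> noeth M fgM e ph.
have [sigma sigma1] := phantom_retraction noeth fgM ph.
have [tau tauE] := sym2_square sigma.
apply: (@retraction_phantom _ _ _ _ tau).
  by apply: sym2_square_inj => //; case: ph.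
by rewrite tauE sigma1 mulr1.
Qed.

End Functional.

Theorem corollary3p12 (R : idomainType) (m : ideal R) (B : comAlgType R) :
  noetherian R -> local_ring m -> big_CM_algebra m B ->
  dietz_closure m (alg_closure B) /\ algebra_axiom (alg_closure B).
Proof.
move=> noeth [max_m _] CM; split; first exact: alg_closure_dietz.
exact: alg_closure_algebra_axiom.
Qed.
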